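(* Let $Y$ be a topological vector space, let $A$ be a closed proper subset of $Y$, let $k\in Y\setminus\{0\}$ be such that $A-\mathbb{R}_{>}k\subseteq\operatorname{int}A$, and let $D\subseteq Y$. Then: (a) $\operatorname{int}A\cap D=\emptyset\iff\varphi_{A,k}(d)\not<0$ for all $d\in D$. (b) $\operatorname{int}A\cap D=\emptyset\implies A\cap\operatorname{int}D=\emptyset\implies\varphi_{A,k}(d)\not\le0$ for all $d\in\operatorname{int}D$. (c) If $D\subseteq\operatorname{cl}\operatorname{int}D$, then: $\operatorname{int}A\cap D=\emptyset\iff A\cap\operatorname{int}D=\emptyset\iff\varphi_{A,k}(d)\not\le0$ for all $d\in\operatorname{int}D$.
   Context: Vector spaces are real; $\mathbb{R}_{>}=\{t\in\mathbb{R}\mid t>0\}$. ''Proper subset of $Y$'' means nonempty and different from $Y$. $\operatorname{int},\operatorname{cl}$ are topological interior and closure. $\nu$ is a symbolic value not in $\overline{\mathbb{R}}=\mathbb{R}\cup\{\pm\infty\}$ and not comparable with any element of $\overline{\mathbb{R}}$ (so $\nu\not\le0$ and $\nu\not<0$ hold); $\inf\emptyset:=\nu$. The function $\varphi_{A,k}:Y\to\overline{\mathbb{R}}\cup\{\nu\}$ is defined by $\varphi_{A,k}(y)=\inf\{t\in\mathbb{R}\mid y\in tk+A\}$. *)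

(* Defs.v *)
From HB Require Import structures.
From mathcomp Require Import all_boot all_order all_algebra.
From mathcomp Require Import all_classical all_reals.
From mathcomp Require Import ereal topology normedtype.

Set Implicit Arguments.
Unset Strict Implicit.
Unset Printing Implicit Defensive.

Import Order.TTheory GRing.Theory Num.Theory.
Import numFieldTopology.Exports numFieldNormedType.Exports.

Local Open Scope classical_set_scope.
Local Open Scope ring_scope.

(* [\bar R] with one additional symbolic value [nu], encoded by [None]. *)
Definition ereal_nu (R : realType) : Type := option (\bar R).

Definition nu {R : realType} : ereal_nu R := None.

(* The symbol [nu] is not comparable with any extended real, so both
   comparisons are false on it. *)
Definition le_nu {R : realType} (x : ereal_nu R) (y : \bar R) : bool :=
  if x is Some r then (r <= y)%E else false.

Definition lt_nu {R : realType} (x : ereal_nu R) (y : \bar R) : bool :=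
  if x is Some r then (r < y)%E else false.

(* Infimum with the convention that the infimum of the empty set is [nu]
   (whereas [ereal_inf set0 = +oo]). *)
Definition inf_nu {R : realType} (E : set R) : ereal_nu R :=
  if E == set0 then nu else Some (ereal_inf [set t%:E | t in E]).

Definition phi {R : realType} {Y : topologicalLmodType R}
    (A : set Y) (k y : Y) : ereal_nu R :=
  inf_nu [set t : R | [set t *: k + a | a in A] y].

(* Main.v *)
Require Import Defs.
From HB Require Import structures.
From mathcomp Require Import all_boot all_order all_algebra.
From mathcomp Require Import all_classical all_reals.
From mathcomp Require Import ereal topology normedtype.

Set Implicit Arguments.
Unset Strict Implicit.
Unset Printing Implicit Defensive.

Import Order.TTheory GRing.Theory Num.Theory.
Import numFieldTopology.Exports numFieldNormedType.Exports.

Local Open Scope classical_set_scope.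
Local Open Scope ring_scope.

(** The functional [phi A k] turns membership in [A] into sign conditions.
Since [A - t k] lies in [interior A] for [0 < t], the sublevel sets of
[phi A k] at level 0 are exactly
<<
  phi A k y < 0   iff   y \in interior A,
  phi A k y <= 0  iff   y \in A
>>
([phi_lt0P] and [phi_le0P]).  For the strict inequality, a value below 0 puts
[y] in [A - t k] for some [0 < t], while a point of an open set can be moved a
little along [k] without leaving the set ([nbhs_ray]).  For the non-strict
one, [phi A k y <= 0] only says that the points [y - s k] with [0 < s] belong to
[A]; these points accumulate at [y], which is where closedness of [A] enters.

With this dictionary, the comparison of [interior A `&` D] and
[A `&` interior D] is purely topological.  A common point [y] of [A] and
[interior D] can be pushed to [y - s k], which lies in [interior A] and, for
some small [s], still in [D].  Conversely, if [D] is contained in the closure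
of its interior, then the open set [interior A] cannot meet [D] without
meeting [interior D]. *)

(** The line [s |-> y + s v] is continuous at 0. The whole topological input of
the sublevel set description is this, with [v] equal to [k] or [- k]. *)
Lemma nbhs_ray (R : realType) (Y : topologicalLmodType R) (y v : Y)
    (U : set Y) :
  nbhs y U -> exists2 s : R, 0 < s & U (y + s *: v).
Proof.
move=> yU.
have scale0 : (s *: v) @[s --> (0 : R^o)] --> (0 : Y).
  rewrite -[X in _ --> X](scale0r v).
  apply: (@continuous2_cvg _ R^o Y Y _ _ (fun s : R^o => s) (fun=> v)
    (fun s w => s *: w)); last exact: cvg_cst; last exact: cvg_id.
  exact: (@scale_continuous R Y (0, v)).
have line : (y + s *: v) @[s --> (0 : R^o)] --> y.
  rewrite -[X in _ --> X](addr0 y).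
  apply: (@continuous2_cvg _ Y Y Y _ _ (fun=> y) (fun s : R^o => s *: v)
    (fun a b => a + b)); [|exact: cvg_cst|exact: scale0].
  exact: (@add_continuous Y (y, 0)).
have /nbhs_ballP[e /= e0 eU] := line _ yU.
exists (e / 2); first exact: divr_gt0.
apply: eU; rewrite /ball /= sub0r normrN gtr0_norm ?divr_gt0//.
by rewrite ltr_pdivrMr// ltr_pMr// ltr1n.
Qed.

Lemma mem_shift (R : realType) (Y : lmodType R) (A : set Y) (k y : Y)
    (t : R) :
  [set t *: k + a | a in A] y <-> A (y - t *: k).
Proof.
split=> [[a Aa <-]|Ay]; first by rewrite addrC addKr.
by exists (y - t *: k) => //; rewrite addrC subrK.
Qed.

(** Anything strictly above an infimum is strictly above some member of the
set; the value [nu] fits in because the set is then empty and [nu] is below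
nothing. *)
Lemma phi_ltP (R : realType) (Y : topologicalLmodType R) (A : set Y)
    (k y : Y) (x : \bar R) :
  lt_nu (phi A k y) x <-> exists2 t : R, (t%:E < x)%E & A (y - t *: k).
Proof.
rewrite /phi /inf_nu; case: eqP => [E0|_] /=; split => //.
- by case=> t _ /mem_shift At; have : set0 t by rewrite -E0.
- by move=> /ereal_inf_lt[_ [t /mem_shift At <-] tx]; exists t.
- case=> t tx /mem_shift At; apply: le_lt_trans tx.
  by apply: ereal_inf_lbound; exists t.
Qed.

Lemma phi_le (R : realType) (Y : topologicalLmodType R) (A : set Y)
    (k y : Y) (t : R) :
  A (y - t *: k) -> le_nu (phi A k y) t%:E.
Proof.
move=> /mem_shift At; rewrite /phi /inf_nu; case: eqP => [E0|_] /=.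
  by have : set0 t by rewrite -E0.
by apply: ereal_inf_lbound; exists t.
Qed.

Lemma le_lt_nu_trans (R : realType) (u : ereal_nu R) (x y : \bar R) :
  le_nu u x -> (x < y)%E -> lt_nu u y.
Proof. by case: u => //= r; exact: le_lt_trans. Qed.

Section sublevel_sets.
Variables (R : realType) (Y : topologicalLmodType R) (A : set Y) (k : Y).
Hypothesis Ak : forall a t, A a -> 0 < t -> interior A (a - t *: k).

Lemma phi_lt0P (y : Y) : lt_nu (phi A k y) 0%E <-> interior A y.
Proof.
split=> [/phi_ltP[t t0 At]|Ay].
  have -> : y = (y - t *: k) - (- t) *: k by rewrite scaleNr opprK subrK.
  by apply: Ak => //; rewrite oppr_gt0 -lte_fin.
have [s s0 As] := nbhs_ray k Ay.
apply/phi_ltP; exists (- s); first by rewrite lte_fin oppr_lt0.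
by rewrite scaleNr opprK.
Qed.

Lemma phi_le0P (y : Y) : closed A -> le_nu (phi A k y) 0%E <-> A y.
Proof.
move=> Acl; split=> [phi0|Ay]; last by apply: phi_le; rewrite scale0r subr0.
apply: Acl => U yU.
have [s s0 Us] := nbhs_ray (- k) yU.
exists (y + s *: - k); split=> //.
(* The infimum is at most 0, hence some t < s satisfies y - t k \in A; the
   remaining displacement s - t is positive and keeps the point in A. *)
have /phi_ltP[t ts At] : lt_nu (phi A k y) s%:E.
  by apply: le_lt_nu_trans phi0 _; rewrite lte_fin.
have -> : y + s *: - k = (y - t *: k) - (s - t) *: k.
  by rewrite scalerN scalerBl opprB addrA subrK.
by apply: interior_subset; apply: Ak => //; rewrite subr_gt0 -lte_fin.
Qed.

(** Moving a common point of [A] and [interior D] slightly in the direction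
[- k] brings it into [interior A] before it leaves [D]. *)
Lemma setI_interior_eq0 (D : set Y) :
  interior A `&` D = set0 -> A `&` interior D = set0.
Proof.
move=> AD0; rewrite -subset0 => y [Ay Dy].
have [s s0 Ds] := nbhs_ray (- k) Dy.
suff : (interior A `&` D) (y + s *: - k) by rewrite AD0.
by split=> //; rewrite scalerN; exact: Ak.
Qed.

End sublevel_sets.

Lemma interior_setI_eq0 (T : topologicalType) (A D : set T) :
  D `<=` closure (interior D) ->
  A `&` interior D = set0 -> interior A `&` D = set0.
Proof.
move=> Dcl AD0; rewrite -subset0 => y [Ay Dy].
have [z [Dz Az]] := Dcl _ Dy _ Ay.
suff : (A `&` interior D) z by rewrite AD0.
by split.
Qed.

Lemma setI_eq0P (T : Type) (A D : set T) :
  A `&` D = set0 <-> forall d, D d -> ~ A d.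
Proof.
split=> [AD0 d Dd Ad|DA]; first by have : set0 d by rewrite -AD0.
by rewrite -subset0 => d [Ad Dd]; exact: DA Dd Ad.
Qed.

Theorem theorem5 (R : realType) (Y : topologicalLmodType R)
    (A : set Y) (k : Y) (D : set Y)
    (A_closed : closed A) (A_neq0 : A !=set0) (A_neqT : A <> [set: Y])
    (k_neq0 : k <> 0)
    (Ak : [set a - t *: k | a in A & t in [set t : R | 0 < t]]
            `<=` interior A) :
  [/\ (* (a) *)
      interior A `&` D = set0 <->
        (forall d, D d -> ~ lt_nu (phi A k d) 0%E),
      (* (b) *)
      (interior A `&` D = set0 -> A `&` interior D = set0) /\
      (A `&` interior D = set0 ->
        forall d, interior D d -> ~ le_nu (phi A k d) 0%E)
    & (* (c) *)
      D `<=` closure (interior D) ->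
      (interior A `&` D = set0 <-> A `&` interior D = set0) /\
      (A `&` interior D = set0 <->
        (forall d, interior D d -> ~ le_nu (phi A k d) 0%E))].
Proof.
have Ak' a t : A a -> 0 < t -> interior A (a - t *: k).
  by move=> Aa t0; apply: Ak; exists a => //; exists t.
have lt0 := phi_lt0P Ak'.
have le0 y := phi_le0P Ak' y A_closed.
have AintD : A `&` interior D = set0 <->
    forall d, interior D d -> ~ le_nu (phi A k d) 0%E.
  by rewrite setI_eq0P; split=> AD d Dd /le0; exact: AD.
split.
- by rewrite setI_eq0P; split=> AD d Dd /lt0; exact: AD.
- by split=> [|/AintD //]; exact: (setI_interior_eq0 Ak').
- move=> Dcl; split; last exact: AintD.
  by split; [exact: (setI_interior_eq0 Ak')|exact: interior_setI_eq0].
Qed.
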